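(* Let $m,n$ be integers with $1\le m\le n$ and $2\le n\le 2m+1$. Then $\dim(VG^1_{m,n})=3$.
   Context: For a connected graph $G$ and an ordered set $R=\{r_1,\dots,r_l\}\subseteq V(G)$, the code of a vertex $s$ is $(d(s,r_1),\dots,d(s,r_l))$, where $d$ is the shortest-path distance. $R$ is a resolving set if distinct vertices have distinct codes; $\dim(G)$ (the metric dimension) is the minimum cardinality of a resolving set. For integers $1\le m\le n$, the Villarceau grid Type I $VG^1_{m,n}$ is the graph with vertex set $\{(2i,2j+1): i\in\{0,\dots,n\},\ j\in\{0,\dots,m-1\}\}\cup\{(2i+1,2j): i\in\{0,\dots,n-1\},\ j\in\{0,\dots,m\}\}$, in which $(i_1,j_1)$ and $(i_2,j_2)$ are adjacent if and only if $|i_1-i_2|=1$ and $|j_1-j_2|=1$. *)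

(* Defs.v *)
From mathcomp Require Import all_boot ssrint zify.
Import IntDist.
Set Implicit Arguments. Unset Strict Implicit. Unset Printing Implicit Defensive.

Record sgraph := SGraph {
  vertex :> finType;
  adj : rel vertex;
  adj_sym : symmetric adj;
  adj_irr : irreflexive adj
}.

Section MetricDimension.
Variable G : sgraph.
Implicit Types (x y s : G) (k : nat).

Definition connected_graph := forall x y, connect (@adj G) x y.

Definition walk k x y : bool :=
  [exists p : k.-tuple G, path (@adj G) x p && (last x p == y)].

(* The least length of a walk from x to y. A shortest walk has fewer than #|G|
   edges; the value #|G| is taken only when y is unreachable from x, so it never
   occurs in a connected graph (see distP). *)
Definition dist x y : nat := find (fun k => walk k x y) (iota 0 #|G|).

Definition code (R : seq G) s : seq nat := [seq dist s r | r <- R].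

Definition resolving (R : seq G) : bool := injectiveb (code R).

Lemma walk_path p x : path (@adj G) x p -> walk (size p) x (last x p).
Proof. by move=> xp; apply/existsP; exists (in_tuple p); rewrite /= xp eqxx. Qed.

Lemma distP x y : connected_graph ->
  walk (dist x y) x y /\ (forall k, walk k x y -> dist x y <= k).
Proof.
move=> /(_ x y) /connectP[p xp ->].
case/shortenP: xp => q xq uq _ {p}.
have lq : size q < #|G| by have /card_uniqP/= <- := uq; apply: max_card.
have hasq : has (fun k => walk k x (last x q)) (iota 0 #|G|).
  by apply/hasP; exists (size q); [rewrite mem_iota | apply: walk_path].
split.
  have := nth_find 0 hasq; rewrite nth_iota //.
  by move: hasq; rewrite has_find size_iota.
move=> k wk; rewrite leqNgt; apply/negP => ltk.
have := before_find 0 ltk; rewrite nth_iota ?add0n ?wk //.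
by apply: leq_trans ltk _; rewrite -[X in _ <= X](size_iota 0) find_size.
Qed.

Lemma dist_eq0 x y : (dist x y == 0) = (x == y).
Proof.
have w0 : walk 0 x y = (x == y).
  apply/existsP/idP => [[p]|xy]; first by rewrite (tuple0 p).
  by exists [tuple].
have : 0 < #|G| by apply/card_gt0P; exists x.
by rewrite /dist; case: #|G| => //= n _; rewrite w0; case: (x == y).
Qed.

(* Ordered sets of k vertices are represented by duplicate-free k-tuples. *)
Definition has_resolving k : bool :=
  [exists R : k.-tuple G, uniq R && resolving R].

Lemma has_resolving_ex : exists k, has_resolving k.
Proof.
exists #|G|; apply/existsP; exists (enum_tuple G).
rewrite enum_uniq; apply/injectiveP => x y /eq_in_map /(_ x).
rewrite mem_enum => /(_ isT) /eqP; rewrite eq_sym.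
have /eqP-> : dist x x == 0 by rewrite dist_eq0.
by rewrite dist_eq0 => /eqP.
Qed.

Definition metric_dim : nat := ex_minn has_resolving_ex.

End MetricDimension.

Section Villarceau.
Variables m n : nat.

Definition VG1_points : seq (nat * nat) :=
  [seq (2 * i, 2 * j + 1) | i <- iota 0 n.+1, j <- iota 0 m] ++
  [seq (2 * i + 1, 2 * j) | i <- iota 0 n, j <- iota 0 m.+1].

Definition VG1_vertex : finType := seq_sub VG1_points.

Definition VG1_adj : rel VG1_vertex := fun u v =>
  (`|(val u).1 - (val v).1|%N == 1) && (`|(val u).2 - (val v).2|%N == 1).

Lemma VG1_adj_sym : symmetric VG1_adj.
Proof. by move=> u v; rewrite /VG1_adj distnC [X in _ && (X == _)]distnC. Qed.

Lemma VG1_adj_irr : irreflexive VG1_adj.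
Proof. by move=> u; rewrite /VG1_adj distnn. Qed.

Definition VG1 : sgraph := SGraph VG1_adj_sym VG1_adj_irr.

Lemma mem_VG1_points a b :
  ((a, b) \in VG1_points) = [&& a <= 2 * n, b <= 2 * m & odd (a + b)].
Proof.
rewrite mem_cat; apply/orP/idP => [[]/allpairsP[[i j]]|].
- by rewrite !mem_iota => -[/= ? ? [-> ->]]; lia.
- by rewrite !mem_iota => -[/= ? ? [-> ->]]; lia.
case/and3P => la lb odd_ab; have [oa|ea] := boolP (odd a).
  right; apply/allpairsP; exists (a./2, b./2).
  by rewrite !mem_iota /=; split; try lia; congr pair; lia.
left; apply/allpairsP; exists (a./2, b./2).
by rewrite !mem_iota /=; split; try lia; congr pair; lia.
Qed.

Lemma VG1_connected : 1 <= m -> m <= n -> connected_graph VG1.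
Proof.
move=> m_gt0 le_mn.
have o_in : (0, 1) \in VG1_points by rewrite mem_VG1_points; lia.
pose o : VG1 := SeqSub o_in.
have csym : connect_sym (@adj VG1) := sym_connect_sym VG1_adj_sym.
suff to_o : forall u, connect (@adj VG1) u o.
  by move=> u v; apply: connect_trans (to_o u) _; rewrite csym.
have step (u : VG1) a b : (a, b) \in VG1_points ->
    `|(val u).1 - a|%N = 1 -> `|(val u).2 - b|%N = 1 ->
    (forall v : VG1, val v = (a, b) -> connect (@adj VG1) v o) ->
    connect (@adj VG1) u o.
  move=> ab_in ua ub /(_ (SeqSub ab_in) erefl); apply: connect_trans.
  by apply: connect1; rewrite /= /VG1_adj /= ua ub.
move=> u; move: {2}((val u).1 + (val u).2) (leqnn ((val u).1 + (val u).2)) => N.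
elim: N u => [|N IH] [[a b] ab_in] /= le_N;
  have /[!mem_VG1_points]/and3P[la lb odd_ab] := ab_in; first by lia.
case: (posnP a) => [a0|a_gt0].
  have [b1|b_neq1] := eqVneq b 1.
    by rewrite (_ : SeqSub ab_in = o) //; apply: val_inj; rewrite /= a0 b1.
  apply: (step _ 1 b.-1) => [|/=|/=|v Ev]; rewrite ?mem_VG1_points; try lia.
  apply: (step _ 0 b.-2) => [|/=|/=|w Ew]; rewrite ?mem_VG1_points ?Ev /=; try lia.
  by apply: IH; rewrite Ew /=; lia.
case: (posnP b) => [b0|b_gt0]; last first.
  apply: (step _ a.-1 b.-1) => [|/=|/=|v Ev]; rewrite ?mem_VG1_points; try lia.
  by apply: IH; rewrite Ev /=; lia.
apply: (step _ a.-1 1) => [|/=|/=|v Ev]; rewrite ?mem_VG1_points; try lia.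
have [a1|a_neq1] := eqVneq a 1.
  by rewrite (_ : v = o) //; apply: val_inj; rewrite Ev a1.
apply: (step _ a.-2 0) => [|/=|/=|w Ew]; rewrite ?mem_VG1_points ?Ev /=; try lia.
by apply: IH; rewrite Ew /=; lia.
Qed.

End Villarceau.

(* Main.v *)
Require Import Defs.
From mathcomp Require Import all_boot ssrint zify.
Import IntDist.

(* In VG1 the distance is the Chebyshev distance: a coordinate that needs no
   change can oscillate inside the box, and parities match.

   Two landmarks never suffice. If a landmark r is interior, two of its four
   neighbours are equidistant from any other vertex s. If both lie on the
   boundary, then by symmetry r = (a, 0) and s is weakly to the right of r; a
   colliding pair can be found within distance 2 of r, unless r and s cut off a
   corner, when it is found just outside that corner.

   Three landmarks suffice: (1, 0), (2n-1, 0) and (2(n-m)-1, 2m) if m < n, and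
   (0, 1), (2n-1, 0) and (2n-1, 2n) if m = n. By parity, the absolute values in
   the distance to a landmark next to a corner can be dropped: for instance
   d((a, b), (1, 0)) = max(a - 1, b) even for a = 0, since then b >= 1. *)

(** * The distance of the grid is the Chebyshev distance *)

Definition gap (a b : nat) : nat := (a - b) + (b - a).

Definition cheb (p q : nat * nat) : nat := maxn (gap p.1 q.1) (gap p.2 q.2).

Lemma distn_gap (a b : nat) : `|a - b|%N = gap a b.
Proof. by rewrite /gap; lia. Qed.

Lemma step_toward N a c : 0 < N -> a <= N -> c <= N -> exists a',
  [/\ a' <= N, gap a a' = 1 &
      gap a' c = if a == c then 1 else (gap a c).-1].
Proof.
move=> N_gt0 aN cN; rewrite /gap; have [ac|ca|ac] := ltngtP a c.
- by exists a.+1; split; lia.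
- by exists a.-1; split; lia.
have [aN'|aN'] := ltnP a N; first by exists a.+1; split; lia.
by exists a.-1; split; lia.
Qed.

Lemma VG1_walk_cheb m n k (x y : VG1 m n) : 1 <= m -> 1 <= n ->
  cheb (val x) (val y) = k -> walk k x y.
Proof.
move=> m_ge1 n_ge1; elim: k x => [|k IH] [[a b] ab] Dk.
  case: y ab Dk => [[c d] cd] ab /= Dk; apply/existsP; exists [tuple] => /=.
  by apply/eqP/val_inj => /=; congr pair; move: Dk; rewrite /cheb /gap /=; lia.
have [z az Dz] : exists2 z : VG1 m n, @VG1_adj m n (SeqSub ab) z &
    cheb (val z) (val y) = k.
  case: y Dk {IH} => [[c d] cd]; rewrite /cheb /= => Dk.
  have := ab; have := cd; rewrite !mem_VG1_points => /and3P[c1 d1 cd_odd].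
  case/and3P=> a1 b1 ab_odd.
  have [|a' [a'N aa' a'c]] := step_toward (2 * n) a c _ a1 c1; first by lia.
  have [|b' [b'N bb' b'd]] := step_toward (2 * m) b d _ b1 d1; first by lia.
  have zP : (a', b') \in VG1_points m n.
    by rewrite mem_VG1_points; rewrite /gap in aa' bb'; lia.
  exists (SeqSub zP); rewrite /= /VG1_adj /=.
    by rewrite !distn_gap aa' bb'.
  (* The two gaps have the same parity. If one is 0, the other is k + 1 and even, so k >= 1, and
     moving the settled coordinate off by 1 does no harm. *)
  rewrite a'c b'd; move: Dk {aa' bb' a'c b'd zP}.
  by rewrite /gap; case: eqP; case: eqP; lia.
have /existsP[p /andP[zp lp]] := IH z Dz.
by apply/existsP; exists [tuple of z :: p]; rewrite /= az zp.
Qed.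

Lemma VG1_walk_ge_cheb m n k (x y : VG1 m n) :
  walk k x y -> cheb (val x) (val y) <= k.
Proof.
case/existsP=> p /andP[+ /eqP <-]; rewrite -[k in _ <= k](size_tuple p).
move: (tval p) => {}p; elim: p x => [|z p IH] x /= => [_|].
  by rewrite /cheb /gap; lia.
case: x z => [[a b] xP] [[c d] zP] /andP[+ /IH].
rewrite /= /VG1_adj !distn_gap /cheb /=.
case: (val (last _ p)) => e f /=; rewrite /gap; lia.
Qed.

Lemma VG1_distE m n (x y : VG1 m n) : 1 <= m -> m <= n ->
  dist x y = cheb (val x) (val y).
Proof.
move=> m_ge1 le_mn; have n_ge1 := leq_trans m_ge1 le_mn.
have [/VG1_walk_ge_cheb le1 min_d] := distP x y (VG1_connected m_ge1 le_mn).
by apply/eqP; rewrite eqn_leq le1 min_d // VG1_walk_cheb.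
Qed.

(** * Any two landmarks leave a colliding pair *)

Definition in_box N M (p : nat * nat) : bool :=
  [&& p.1 <= N, p.2 <= M & odd (p.1 + p.2)].

(** The sides are free, not [2 * n] and [2 * m] with m <= n, so that transposition applies. The case
    r = s covers fewer than two landmarks. *)
Definition collide N M (r s : nat * nat) : Prop := exists x y,
  [/\ in_box N M x, in_box N M y, x <> y,
      cheb x r = cheb y r & cheb x s = cheb y s].

Lemma collideC N M r s : collide N M r s -> collide N M s r.
Proof. by case=> x [y [*]]; exists x, y. Qed.

(** The last condition on f is what an involutive isometry satisfies. It is asked only at r and s
    because the reflection uses truncated subtraction. *)
Lemma collide_map (f : nat * nat -> nat * nat) N M N' M' r s :
    (forall p, in_box N' M' p -> in_box N M (f p)) ->
    {in in_box N' M' &, injective f} ->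
    (forall p q, in_box N' M' p -> q \in [:: r; s] ->
      cheb (f p) q = cheb p (f q)) ->
  collide N' M' (f r) (f s) -> collide N M r s.
Proof.
move=> f_box f_inj f_cheb [x [y [xB yB neq_xy er es]]]; exists (f x), (f y).
split; [exact: f_box | exact: f_box | | |].
- by move/f_inj => /(_ xB yB).
- by rewrite !f_cheb // mem_head.
- by rewrite !f_cheb // inE mem_head orbT.
Qed.

Lemma collide_swap N M a b c d :
  collide M N (b, a) (d, c) -> collide N M (a, b) (c, d).
Proof.
apply: (@collide_map (fun p => (p.2, p.1)) N M M N (a, b) (c, d)).
- by move=> [x y]; rewrite /in_box /= addnC andbCA.
- by move=> [x y] [x' y'] _ _ [-> ->].
- by move=> [x y] [x' y'] _ _; rewrite /cheb /= maxnC.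
Qed.

Lemma collide_flip N M a b c d : ~~ odd N -> a <= N -> c <= N ->
  collide N M (N - a, b) (N - c, d) -> collide N M (a, b) (c, d).
Proof.
move=> evN aN cN.
apply: (@collide_map (fun p => (N - p.1, p.2)) N M N M (a, b) (c, d)).
- move=> [x y] /and3P[/= xN yM]; rewrite /in_box /= leq_subr yM.
  by rewrite !oddD oddB // (negbTE evN).
- move=> [x y] [x' y'] /and3P[/= xN _ _] /and3P[/= x'N _ _] [eN ->].
  by congr pair; rewrite -(subKn xN) eN subKn.
- move=> [x y] q /and3P[/= xN _ _]; rewrite !inE => qE.
  have qN : q.1 <= N by case/orP: qE => /eqP->.
  by case: q qN {qE} => [q1 q2] /= qN; rewrite /cheb /gap /=; congr maxn; lia.
Qed.

Ltac collision x y :=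
  exists x, y; rewrite /in_box /cheb; unfold gap in *; split=> /=;
    [lia | lia | case; lia | lia | lia].

Lemma collide_interior N M a b c d :
  odd (a + b) -> odd (c + d) -> 0 < a < N -> 0 < b < M ->
  collide N M (a, b) (c, d).
Proof.
move=> oab ocd aN bM.
(* By parity a strict inequality has margin 2, so the larger gap still decides the distance after
   one diagonal step, whatever the other coordinate does. *)
have [lt1|] := ltnP (gap b d) (gap a c).
  by collision (a.+1, b.+1) (a.+1, b.-1).
rewrite leq_eqVlt => /orP[/eqP eq1|lt1]; last first.
  by collision (a.+1, b.+1) (a.-1, b.+1).
(* Now s is on a diagonal through r; the neighbours of r on the other diagonal collide. *)
have [dd|dd] : a + d = b + c \/ a + b = c + d by rewrite /gap in eq1; lia.
  by clear eq1; collision (a.+1, b.-1) (a.-1, b.+1).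
by clear eq1; collision (a.+1, b.+1) (a.-1, b.-1).
Qed.

(** The bound [6 <= N + M] excludes only N = M = 2, a 4-cycle, which two adjacent vertices
    resolve. *)
Lemma collide_bottom N M a c d : ~~ odd N -> ~~ odd M -> 2 <= N -> 2 <= M ->
  6 <= N + M -> in_box N M (a, 0) -> in_box N M (c, d) ->
  collide N M (a, 0) (c, d).
Proof.
move=> evN evM N2 M2 NM.
wlog le_ac : a c / a <= c => [wl|].
  move=> ha hc; case: (leqP a c) => ac; first exact: wl.
  move: (ha) (hc); rewrite /in_box /= => ha' hc'.
  apply: collide_flip; try lia.
  by apply: wl; rewrite /in_box /=; lia.
rewrite /in_box /= => ha hc.
have [lt1|] := ltnP (c - a) d; first by collision (a.+1, 1) (a.-1, 1).
rewrite leq_eqVlt => /orP[/eqP Ed|lt1]; last first.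
  have [le3|lt3] := leqP 3 (c - a); first by collision (a + 2, 2) (a + 2, 0).
  (* By parity s = (a + 2, 0). *)
  by collision (a, 2) (a + 2, 2).
(* Now s is on the diagonal c = a + d rising from r; the pair is symmetric about it. *)
have [le2|lt2] := leqP 2 d; first by collision (a + 2, 0) (a, 2).
have [d0|d1] := posnP d; first by collision (a.+1, 1) (a.-1, 1).
have [cN|cN] := ltnP c N.
  by apply/collideC/collide_interior; lia.
(* Here r = (N - 1, 0) and s = (N, 1) cut off a corner. *)
have [N4|N4] := leqP 4 N; first by collision (N - 3, 0) (N - 3, 2).
(* Here N = 2, so M >= 4 and row 3 exists. *)
by collision (0, 3) (2, 3).
Qed.

Lemma collide_left N M b c d : ~~ odd N -> ~~ odd M -> 2 <= N -> 2 <= M ->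
  6 <= N + M -> in_box N M (0, b) -> in_box N M (c, d) ->
  collide N M (0, b) (c, d).
Proof.
rewrite /in_box /= => *; apply/collide_swap/collide_bottom => //.
all: by rewrite /in_box /=; lia.
Qed.

Lemma collide_right N M b c d : ~~ odd N -> ~~ odd M -> 2 <= N -> 2 <= M ->
  6 <= N + M -> in_box N M (N, b) -> in_box N M (c, d) ->
  collide N M (N, b) (c, d).
Proof.
rewrite /in_box /= => *; apply: collide_flip; rewrite ?subnn; try lia.
by apply: collide_left; rewrite /in_box /=; lia.
Qed.

Lemma collide_any N M r s : ~~ odd N -> ~~ odd M -> 2 <= N -> 2 <= M ->
  6 <= N + M -> in_box N M r -> in_box N M s -> collide N M r s.
Proof.
case: r s => [a b] [c d] evN evM N2 M2 NM ab cd.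
have [a0|a_gt0] := posnP a; first by rewrite a0 in ab *; apply: collide_left.
have [b0|b_gt0] := posnP b; first by rewrite b0 in ab *; apply: collide_bottom.
have [aN|aN] := eqVneq a N; first by rewrite aN in ab *; apply: collide_right.
move: ab cd; rewrite /in_box /= => ab cd.
have [bM|bM] := eqVneq b M; last by apply: collide_interior; lia.
rewrite bM in ab *; apply/collide_swap/collide_right => //.
all: by rewrite /in_box /=; lia.
Qed.

(** * Three resolving landmarks *)

Lemma cheb_bottom_left a b k : odd (a + b) -> cheb (a, b) (1, 0) = k ->
  [/\ a <= k + 1, b <= k & a = k + 1 \/ b = k].
Proof. by rewrite /cheb /gap /= => ab <-; split; lia. Qed.

Lemma cheb_left_bottom a b k : odd (a + b) -> cheb (a, b) (0, 1) = k ->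
  [/\ a <= k, b <= k + 1 & a = k \/ b = k + 1].
Proof. by rewrite /cheb /gap /= => ab <-; split; lia. Qed.

Lemma cheb_bottom_right p a b k : odd p -> odd (a + b) -> a <= p + 1 ->
  cheb (a, b) (p, 0) = k ->
  [/\ p <= a + k, b <= k & p = a + k \/ b = k].
Proof. by rewrite /cheb /gap /= => op ab ap <-; split; lia. Qed.

(** The landmark may be far from both corners, so both signs of a - p remain. *)
Lemma cheb_top M p a b k : b <= M -> cheb (a, b) (p, M) = k ->
  [/\ a <= p + k, p <= a + k, M <= b + k &
      a = p + k \/ p = a + k \/ M = b + k].
Proof. by rewrite /cheb /gap /= => bM <-; split; lia. Qed.

Lemma odd_exists k : odd k -> exists l, k = 2 * l + 1.
Proof. by move=> ok; exists k./2; lia. Qed.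

(** The third landmark is the top end of the antidiagonal a + b = 2n - 1 from the second. Cut the
    box by this line and by the diagonal b = a - 1 from (1, 0). In the left and right regions the
    first two distances give a and b. In the bottom region they give only a, and the third is 2m -
    b, thanks to n <= 2m + 1. In the top region they give only b, and the third is a - (2(n - m) -
    1). *)
Lemma landmarks_lt m n x y : m < n -> n <= 2 * m + 1 ->
  in_box (2 * n) (2 * m) x -> in_box (2 * n) (2 * m) y ->
  cheb x (1, 0) = cheb y (1, 0) ->
  cheb x (2 * n - 1, 0) = cheb y (2 * n - 1, 0) ->
  cheb x (2 * (n - m) - 1, 2 * m) = cheb y (2 * (n - m) - 1, 2 * m) -> x = y.
Proof.
move=> lt_mn; have [g ->] : exists g, n = m + g + 1 by exists (n - m).-1; lia.
move: x y => [a b] [c d] n_le /and3P[/= aN bM ab] /and3P[/= cN dM cd].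
have -> : 2 * (m + g + 1) - 1 = 2 * (m + g) + 1 by lia.
have -> : 2 * (m + g + 1 - m) - 1 = 2 * g + 1 by lia.
have op : odd (2 * (m + g) + 1) by lia.
have ap : a <= 2 * (m + g) + 1 + 1 by lia.
have cp : c <= 2 * (m + g) + 1 + 1 by lia.
move=> /(cheb_bottom_left _ _ _ ab)[a1 b1 xL].
move=> /(cheb_bottom_right _ _ _ _ op ab ap)[a2 b2 xR].
move=> /(cheb_top _ _ _ _ _ bM)[a3 a4 b3 xT].
have [c1 d1 yL] := cheb_bottom_left _ _ _ cd erefl.
have [c2 d2 yR] := cheb_bottom_right _ _ _ _ op cd cp erefl.
have [c3 c4 d3 yT] := cheb_top _ (2 * g + 1) c _ _ dM erefl.
have [k Ek] := odd_exists _ ab; have [l El] := odd_exists _ cd.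
suff [-> ->] : a = c /\ b = d by [].
by case: xL => xL; case: yL => yL; case: xR => xR; case: yR => yR;
  case: xT => [xT|[xT|xT]]; case: yT => [yT|[yT|yT]]; lia.
Qed.

(** The first and third landmarks lie on the diagonal b = a + 1, so their distances fix a point up
    to reflection in it. The second is strictly closer to whichever image is on its own side. *)
Lemma landmarks_eq n x y : 1 < n ->
  in_box (2 * n) (2 * n) x -> in_box (2 * n) (2 * n) y ->
  cheb x (0, 1) = cheb y (0, 1) ->
  cheb x (2 * n - 1, 0) = cheb y (2 * n - 1, 0) ->
  cheb x (2 * n - 1, 2 * n) = cheb y (2 * n - 1, 2 * n) -> x = y.
Proof.
move=> n_gt1; have [p Ep] : exists p, p + 1 = 2 * n by exists (2 * n).-1; lia.
have -> : 2 * n - 1 = p by lia.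
move: x y => [a b] [c d] /and3P[/= aN bM ab] /and3P[/= cN dM cd].
have op : odd p by lia.
have ap : a <= p + 1 by lia.
have cp : c <= p + 1 by lia.
move=> /(cheb_left_bottom _ _ _ ab)[a1 b1 xL].
move=> /(cheb_bottom_right _ _ _ _ op ab ap)[a2 b2 xR].
move=> /(cheb_top _ _ _ _ _ bM)[a3 a4 b3 xT].
have [c1 d1 yL] := cheb_left_bottom _ _ _ cd erefl.
have [c2 d2 yR] := cheb_bottom_right _ _ _ _ op cd cp erefl.
have [c3 c4 d3 yT] := cheb_top _ p c _ _ dM erefl.
have [k Ek] := odd_exists _ ab; have [l El] := odd_exists _ cd.
suff [-> ->] : a = c /\ b = d by [].
by case: xL => xL; case: yL => yL; case: xR => xR; case: yR => yR;
  case: xT => [xT|[xT|xT]]; case: yT => [yT|[yT|yT]]; lia.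
Qed.

(** * Transfer to the graph and its metric dimension *)

Lemma VG1_points_box m n p : (p \in VG1_points m n) = in_box (2 * n) (2 * m) p.
Proof. by case: p => a b; rewrite mem_VG1_points. Qed.

Lemma VG1_box m n (v : VG1 m n) : in_box (2 * n) (2 * m) (val v).
Proof. by rewrite -VG1_points_box ssvalP. Qed.

Lemma eq_map_size2 (T U : Type) (f g : T -> U) (t : seq T) x :
    size t <= 2 -> f (nth x t 0) = g (nth x t 0) ->
    f (nth (nth x t 0) t 1) = g (nth (nth x t 0) t 1) ->
  [seq f y | y <- t] = [seq g y | y <- t].
Proof. by case: t => [|u [|v [|]]] //= _ => [-> | -> ->]. Qed.

Lemma VG1_not_resolving2 m n k : 1 <= m -> m <= n -> 2 <= n -> k <= 2 ->
  ~~ has_resolving (VG1 m n) k.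
Proof.
move=> m_ge1 le_mn n_ge2 k_le2.
apply/existsP => -[R /andP[_ /injectiveP R_inj]].
have o_in : (0, 1) \in VG1_points m n by rewrite mem_VG1_points; lia.
(* Defaults pad a short tuple: r is (0, 1) if k = 0, and s is r if k <= 1. *)
pose r := nth (SeqSub o_in : VG1 m n) R 0; pose s := nth r R 1.
have [|||||x' [y' [xB yB neq_xy er es]]] :=
  collide_any (2 * n) (2 * m) (val r) (val s) _ _ _ _ _
    (VG1_box _ _ r) (VG1_box _ _ s); try lia.
rewrite -!VG1_points_box in xB yB.
apply: neq_xy; pose x : VG1 m n := SeqSub xB; pose y : VG1 m n := SeqSub yB.
suff /R_inj/(congr1 val) : code R x = code R y by [].
have rxy : dist x r = dist y r by rewrite !VG1_distE.
have sxy : dist x s = dist y s by rewrite !VG1_distE.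
apply: (@eq_map_size2 _ _ (dist x) (dist y) R (SeqSub o_in) _ rxy sxy).
by rewrite size_tuple.
Qed.

Lemma VG1_resolving3 m n (r s t : nat * nat) : 1 <= m -> m <= n ->
    in_box (2 * n) (2 * m) r -> in_box (2 * n) (2 * m) s ->
    in_box (2 * n) (2 * m) t -> uniq [:: r; s; t] ->
    (forall x y, in_box (2 * n) (2 * m) x -> in_box (2 * n) (2 * m) y ->
      cheb x r = cheb y r -> cheb x s = cheb y s -> cheb x t = cheb y t ->
      x = y) ->
  has_resolving (VG1 m n) 3.
Proof.
rewrite -!VG1_points_box => m_ge1 le_mn rV sV tV rst_uniq rst_inj.
pose v p (pV : p \in VG1_points m n) : VG1 m n := SeqSub pV.
apply/existsP; exists [tuple v r rV; v s sV; v t tV].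
rewrite -(map_inj_uniq val_inj).
rewrite rst_uniq /=; apply/injectiveP => x y; rewrite /code /= !VG1_distE //.
by case=> er es et; apply/val_inj/rst_inj => //; apply: VG1_box.
Qed.

Theorem theorem2 (m n : nat) (m_ge1 : 1 <= m) (m_le_n : m <= n)
  (n_ge2 : 2 <= n) (n_le : n <= 2 * m + 1) :
  metric_dim (VG1 m n) = 3.
Proof.
rewrite /metric_dim; case: ex_minnP => k k_res k_min; apply/eqP.
rewrite eqn_leq ltnNge (contraL _ k_res) ?andbT; last exact: VG1_not_resolving2.
apply: k_min; have [lt_mn|le_nm] := ltnP m n.
  apply: VG1_resolving3 (fun x y => landmarks_lt m n x y lt_mn n_le) => //;
    by rewrite /in_box /= ?inE /eq_op /=; lia.
have -> : n = m by apply/eqP; rewrite eqn_leq le_nm.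
apply: VG1_resolving3 (fun x y => landmarks_eq m x y _) => //;
  by rewrite /in_box /= ?inE /eq_op /=; lia.
Qed.
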